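(* There is a $C$-sequence $\vec{C} = \langle C_\alpha \mid \alpha \in \lim(\omega_1) \rangle$ such that, for every sequence $\vec{t} = \langle t_k \mid k < \omega \rangle$ of disjoint types with bounded width, $\vec{C}$ is a strong $\vec{t}$-guessing sequence. In fact, $\vec{C}$ can be chosen so that the following formally stronger statement holds for every such $\vec{t}$: for every $f : \omega_1 \rightarrow \omega$, there are $\beta \in \lim(\omega_1)$ and $k < \omega$ such that $f(\beta) = k$ and, for every $\eta < \beta$, there is $\alpha \in \lim(\beta)$ such that, letting $n := \mathrm{width}(t_k)$, we have (i) $f(\alpha) = k$; (ii) $\mathrm{type}(C_\alpha[n], C_\beta[n]) = t_k$ (in particular, $C_\alpha[n]$ and $C_\beta[n]$ are disjoint); (iii) $C_\alpha(n) > \eta$.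
   Context: The background theory is ZFC. For an ordinal $\beta$, $\lim(\beta)$ is the set of limit ordinals less than $\beta$ (0 is not a limit ordinal). $[X]^n$ is the set of $n$-element subsets of $X$. If $a$ is a set of ordinals and $i < \mathrm{ot}(a)$, then $a(i)$ is the unique $\gamma \in a$ such that $a \cap \gamma$ has order type $i$; for $I \subseteq \mathrm{ot}(a)$, $a[I] := \{a(i) \mid i \in I\}$. A natural number $n$ is identified with $\{0,\dots,n-1\}$, so $a[n]$ is the set of the first $n$ elements of $a$. A $C$-sequence is a sequence $\langle C_\alpha \mid \alpha \in \lim(\omega_1)\rangle$ such that each $C_\alpha$ is a cofinal subset of $\alpha$ of order type $\omega$. A disjoint type of width $n$ ($n$ a natural number) is a function $t : 2n \to 2$ with $|\{i<2n \mid t(i)=0\}| = |\{i<2n \mid t(i)=1\}| = n$; we write $\mathrm{width}(t) = n$. If $a,b$ are disjoint $n$-element sets of ordinals and $a \cup b = \{\alpha_0 < \alpha_1 < \dots < \alpha_{2n-1}\}$, then $\mathrm{type}(a,b)$ is the unique disjoint type $t$ of width $n$ such that $a = \{\alpha_i \mid i<2n,\ t(i)=0\}$ and $b = \{\alpha_i \mid i<2n,\ t(i)=1\}$. The opposite type $\bar t$ of $t$ is given by $\bar t(i) = 1 - t(i)$. A sequence $\langle t_k \mid k<\omega\rangle$ of disjoint types has bounded width if $\sup\{\mathrm{width}(t_k) \mid k<\omega\} < \omega$. Let $\vec C$ be a $C$-sequence and $\vec t = \langle t_k \mid k<\omega\rangle$ a sequence of disjoint types. $\vec C$ is a strong $\vec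 t$-guessing sequence if, for every $f : \omega_1 \to \omega$, there is $\beta \in \lim(\omega_1)$ such that, with $k = f(\beta)$ and $n = \mathrm{width}(t_k)$, the set of $\alpha \in \lim(\beta)$ for which $f(\alpha) = k$ and $\mathrm{type}(C_\alpha[n], C_\beta[n]) \in \{t_k, \bar t_k\}$ (in particular, $C_\alpha[n]$ and $C_\beta[n]$ are disjoint) is unbounded in $\beta$. *)

(* Defs.v *)
From HB Require Import structures.
From mathcomp Require Import all_boot all_order.
From mathcomp Require Import boolp classical_sets functions cardinality wochoice.

Set Implicit Arguments.
Unset Strict Implicit.
Unset Printing Implicit Defensive.

Import Order.TTheory.

Local Open Scope order_scope.
Local Open Scope classical_set_scope.
Local Open Scope card_scope.

(* omega_1 is, up to a unique isomorphism, the only uncountable well-ordered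
   set all of whose proper initial segments are countable; its elements are
   the countable ordinals.  Existence is [omega1_exists] below. *)
Definition is_omega1 (d : Order.disp_t) (W : orderType d) : Prop :=
  [/\ well_order (fun x y : W => x <= y),
      ~ countable [set: W]
    & forall a : W, countable [set x : W | x < a]].

Lemma omega1_exists : exists (d : Order.disp_t) (W : orderType d), is_omega1 W.
Proof.
suff [T [R [Rwo ncT cT]]] : exists (T : choiceType) (R : rel T),
    [/\ well_order R, ~ countable [set: T]
      & forall a, countable [set x | (a != x) && R x a]].
  have Rch : wo_chain R predT by move=> A _; exact: Rwo.
  have Rtot : total R by move=> x y; exact: (wo_chainW Rch).
  have Ranti : antisymmetric R.
    by move=> x y; exact: (wo_chain_antisymmetric Rch).
  have Rtr : transitive R.
    move=> y x z Rxy Ryz.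
    have [|m [[mA mlb] _]] := Rwo [pred u | [|| u == x, u == y | u == z]].
      by exists x; rewrite inE eqxx.
    have mx := mlb x _; have my := mlb y _; have mz := mlb z _.
    rewrite !inE !eqxx ?orbT in mx my mz.
    move: mA; rewrite !inE => /or3P[]/eqP E; subst m.
    - exact: mz.
    - by have -> : x = y by apply: Ranti; rewrite Rxy mx.
    - have E : y = z by apply: Ranti; rewrite Ryz my.
      by rewrite -E.
  pose l x y := (y != x) && R x y.
  pose m x y := if l x y then x else y.
  pose j x y := if l x y then y else x.
  pose B := @Order.isOrder.Axioms_ (Order.Disp tt tt) T
    (Choice.choice_hasChoice_mixin (Choice.class T)) _ R l m j
    (fun _ _ => erefl) (fun _ _ => erefl) (fun _ _ => erefl) Ranti Rtr Rtot.
  pose W : orderType (Order.Disp tt tt) := HB.pack T B.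
  by exists (Order.Disp tt tt), W.
have ncS : ~ countable [set: set nat].
  move=> /countable_injP[f finj].
  pose D := [set n : nat | exists2 A : set nat, f A = n & ~ A n].
  have [DD|nDD] := pselect (D (f D)).
    have [A fA nA] := DD; apply: nA.
    by rewrite (finj A D (in_setT _) (in_setT _) fA).
  by apply: (nDD); exists D.
have [R Rwo] := well_ordering_principle (set nat : eqType).
have Rch : wo_chain R predT by move=> A _; exact: Rwo.
pose below a := [set x : set nat | (a != x) && R x a].
have [cR|] := pselect (forall a, countable (below a)).
  by exists (set nat : choiceType), R; split.
move=> /existsNP[a0 a0P].
have [|a [[/asboolP aP amin] _]] := Rwo [pred a | `[< ~ countable (below a) >]].
  by exists a0; apply/asboolP.
pose T := {x : set nat | (a != x) && R x a}.
exists (T : choiceType), (relpre val R); split.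
- apply: antisymmetric_well_order.
    move=> x y /= /(wo_chain_antisymmetric Rch (isT : _ \in predT) (isT : _ \in predT)).
    exact: val_inj.
  move=> A [x0 x0A].
  have [|z [[/asboolP[z' z'A <-] zmin] _]] :=
    Rwo [pred u | `[< exists2 z : T, z \in A & val z = u >]].
    by exists (val x0); apply/asboolP; exists x0.
  exists z'; split=> // y yA; apply: zmin.
  by apply/asboolP; exists y.
- move=> /countable_injP[f finj]; apply: aP; apply/countable_injP.
  exists (fun x => if insub x is Some u then f u else 0%N) => x y.
  pose P u := (a != u) && R u a.
  rewrite !inE /below /= => xa ya.
  rewrite (insubT P xa) (insubT P ya) => E.
  by have /(congr1 val) := finj _ _ (in_setT _) (in_setT _) E.
- move=> b; have cb : countable (below (val b)).
    apply: contrapT => /asboolP nb; have Rab := amin _ nb.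
    have /andP[nab Rba] := valP b.
    have ab := wo_chain_antisymmetric Rch (isT : a \in predT) (isT : val b \in predT).
    by move/eqP: nab; apply; apply: ab; rewrite Rab.
  move/countable_injP: cb => [f finj]; apply/countable_injP; exists (f \o val).
  move=> x y; rewrite !inE /= => /andP[xb Rx] /andP[yb Ry] E; apply: val_inj.
  by apply: finj => //; rewrite inE /below /= ?Rx ?Ry andbT.
Qed.

Section Ordinals.
Context {d : Order.disp_t} {W : orderType d}.
Implicit Types (A B : set W) (a b eta : W).

Definition limit_ordinal a : Prop :=
  (exists b, b < a) /\ (forall b, b < a -> exists2 c, b < c & c < a).

Definition limits_below b : set W := [set a | limit_ordinal a /\ a < b].

Definition unbounded_in A b : Prop :=
  forall eta, eta < b -> exists2 a, A a & eta < a.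

Definition has_order_type {d' : Order.disp_t} (T : orderType d') A : Prop :=
  exists e : T -> W, {homo e : i j / i < j} /\ range e = A.

(* [nth_elt A i g] : A(i) exists and is equal to g; by uniqueness of order
   types such a g is unique. *)
Definition nth_elt A (i : nat) (g : W) : Prop :=
  A g /\ has_order_type 'I_i (A `&` [set x | x < g]).

Definition elts_at A (I : set nat) : set W :=
  [set g | exists2 i, I i & nth_elt A i g].

(* Only the values of C at limit ordinals matter here and below. *)
Definition C_sequence (C : W -> set W) : Prop :=
  forall a, limit_ordinal a ->
    [/\ C a `<=` [set x | x < a], unbounded_in (C a) a
      & has_order_type nat (C a)].

End Ordinals.

(* The values 0 and 1 of a type are encoded by false and true. *)
Record disjoint_type := DisjointType {
  width : nat;
  dt_fun :> 'I_(2 * width)%N -> bool;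
  dt_card0 : #|[pred i | dt_fun i == false]| = width;
  dt_card1 : #|[pred i | dt_fun i == true]| = width }.

Lemma opp_type_card (t : disjoint_type) (c : bool) :
  #|[pred i | ~~ t i == c]| = width t.
Proof.
case: c.
  by rewrite -[RHS](dt_card0 t); apply: eq_card => i; rewrite !inE; case: (t i).
by rewrite -[RHS](dt_card1 t); apply: eq_card => i; rewrite !inE; case: (t i).
Qed.

Definition opp_type (t : disjoint_type) : disjoint_type :=
  @DisjointType (width t) (fun i => ~~ t i)
    (opp_type_card t false) (opp_type_card t true).

Definition bounded_width (t : nat -> disjoint_type) : Prop :=
  exists N : nat, forall k, (width (t k) <= N)%N.

Section Guessing.
Context {d : Order.disp_t} {W : orderType d}.
Implicit Types (A B : set W) (C : W -> set W) (t : nat -> disjoint_type).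

(* type(A, B) is defined and equal to t; [al] is the increasing enumeration
   of the union of A and B. *)
Definition has_type A B (t : disjoint_type) : Prop :=
  [/\ A #= `I_(width t), B #= `I_(width t), A `&` B = set0
    & exists al : 'I_(2 * width t)%N -> W,
      [/\ {homo al : i j / i < j}, range al = A `|` B,
          A = al @` [set i | t i = false] & B = al @` [set i | t i = true]]].

Definition strong_guessing C t : Prop :=
  forall f : W -> nat, exists2 b : W, limit_ordinal b &
    let k := f b in
    let n := width (t k) in
    unbounded_in
      [set a | [/\ limits_below b a, f a = k
                 & has_type (elts_at (C a) `I_n) (elts_at (C b) `I_n) (t k) \/
                   has_type (elts_at (C a) `I_n) (elts_at (C b) `I_n)
                     (opp_type (t k))]]
      b.

Definition stronger_guessing C t : Prop :=
  forall f : W -> nat, exists (b : W) (k : nat),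
    [/\ limit_ordinal b, f b = k
      & forall eta : W, eta < b -> exists2 a : W, limits_below b a &
          let n := width (t k) in
          [/\ f a = k,
              has_type (elts_at (C a) `I_n) (elts_at (C b) `I_n) (t k)
            & exists2 g : W, nth_elt (C a) n g & eta < g]].

End Guessing.

(* Main.v *)
(** Let [e a] inject the ordinals below [a] into the natural numbers.  Splitting
    a stationary set by the values of [e a g] (Ulam) gives, for each length [N],
    a sequence [s N] such that, for unboundedly many [g_0], unboundedly many
    [g_1], ..., the set of all [a] with [e a g_i = (s N)_i] for [i < N] is
    stationary, and this holds inside a stationary set [D N], the [D N] being
    pairwise disjoint.  For [a] in [D N] the first [N] elements of [C a] are
    [g_0 < ... < g_(N-1)], determined by [a] because [e a] is injective.

    Given [t] of width at most [B] and [f], take [N = B + 1].  Pigeonhole along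
    the tree of sequences gives one colour [k] for which the above still holds
    inside [f = k].  With [n] the width of [t k], unbounded branching lets one
    interleave two branches of length [n] according to [t k]; extend the second
    one to length [N] and pick [b] there, closed under the function that sends
    [eta] to some [a] lying over an extension of the first branch beyond
    [eta]. *)

Require Import Defs.
From mathcomp Require Import all_boot all_order.
From mathcomp Require Import boolp classical_sets functions cardinality.

Set Implicit Arguments.
Unset Strict Implicit.
Unset Printing Implicit Defensive.

Import Order.TTheory.

Local Open Scope order_scope.
Local Open Scope classical_set_scope.
Local Open Scope card_scope.

(** * Well-foundedness and countable suprema in omega_1 *)

Section Omega1.
Context {d : Order.disp_t} {W : orderType d} (W_omega1 : is_omega1 W).
Implicit Types (A B : set W) (P : W -> Prop).

Lemma least_element P : (exists x, P x) ->
  exists2 x, P x & forall y, P y -> x <= y.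
Proof.
have [wo _ _] := W_omega1.
move=> [x Px]; have [|z [[/asboolP Pz zmin] _]] := wo [pred u | `[< P u >]].
  by exists x; apply/asboolP.
by exists z => // y Py; apply: zmin; apply/asboolP.
Qed.

Lemma omega1_inhabited : exists x : W, True.
Proof.
have [_ ncW _] := W_omega1.
apply: contrapT => nW; apply: ncW; suff -> : [set: W] = set0 by [].
by apply/seteqP; split=> // x _; case: nW; exists x.
Qed.

(** Otherwise omega_1 would be a countable union of the countable sets of points up to [u i]. *)
Lemma countable_bounded (T : countType) (u : T -> W) : exists b, forall i, u i < b.
Proof.
have [_ ncW cW] := W_omega1; apply: contrapT => nb; apply: ncW.
suff -> : [set: W] = \bigcup_(i in [set: T]) ([set x | x < u i] `|` [set u i]).
  apply: bigcup_countable => // i _; rewrite -bigcup2E.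
  apply: bigcup_countable => // -[|[|j]] _ //=.
apply/seteqP; split=> // x _; apply: contrapT => nx; apply: nb; exists x => i.
rewrite ltNge; apply/negP => xu; apply: nx; exists i => //=.
by move: xu; rewrite le_eqVlt => /orP[/eqP|]; [right|left].
Qed.

Lemma exists_gt2 (x y : W) : exists2 z, x < z & y < z.
Proof.
have [z zP] := countable_bounded (fun b : bool => if b then x else y).
by exists z; [exact: (zP true)|exact: (zP false)].
Qed.

(** * The quantifier [for unboundedly many] and its iteration along finite sequences *)

Definition unboundedly_many P := forall x, exists2 y, x < y & P y.

Lemma unboundedly_many_mono P (P' : W -> Prop) : (forall x, P x -> P' x) ->
  unboundedly_many P -> unboundedly_many P'.
Proof. by move=> PP' PQ x; have [y xy /PP'] := PQ x; exists y. Qed.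

(** If each [P k] failed above some [u k], all of them would fail above a common bound of the
    [u k]. *)
Lemma unboundedly_many_pigeonhole (T : countType) (P : T -> W -> Prop) :
  unboundedly_many (fun x => exists k, P k x) -> exists k, unboundedly_many (P k).
Proof.
move=> PU; apply: contrapT => nP.
have /choice[u uP] : forall k, exists x, forall y, x < y -> ~ P k y.
  move=> k; apply: contrapT => nk; apply: nP; exists k => x.
  apply: contrapT => nx; apply: nk; exists x => y xy Py; apply: nx.
  by exists y.
have [b bP] := countable_bounded u.
have [y by_ [k Pky]] := PU b.
exact: (uP k y (lt_trans (bP k) by_)).
Qed.

(* "For unboundedly many x_0, for unboundedly many x_1, ..., P [:: x_0; x_1; ...]". *)
Fixpoint many_seqs n (P : seq W -> Prop) : Prop :=
  if n is n'.+1 then unboundedly_many (fun x => many_seqs n' (fun c => P (x :: c)))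
  else P [::].

Lemma many_seqs_mono n (P P' : seq W -> Prop) :
  (forall c, P c -> P' c) -> many_seqs n P -> many_seqs n P'.
Proof.
elim: n P P' => [|n IH] P P' PP' /=; first exact: PP'.
by apply: unboundedly_many_mono => x; apply: IH => c; exact: PP'.
Qed.

(** By induction each first element has its own colour; the one-step pigeonhole then makes it the
    same for unboundedly many. *)
Lemma many_seqs_pigeonhole (T : countType) n (P : T -> seq W -> Prop) :
  many_seqs n (fun c => exists k, P k c) -> exists k, many_seqs n (P k).
Proof.
elim: n P => [|n IH] P //= PU; apply: unboundedly_many_pigeonhole.
by move: PU; apply: unboundedly_many_mono => x /IH.
Qed.

Lemma many_seqs_cat m n (P : seq W -> Prop) : many_seqs (m + n) P ->
  many_seqs m (fun a => many_seqs n (fun c => P (a ++ c))).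
Proof.
elim: m P => [|m IH] P //=; apply: unboundedly_many_mono => x.
exact: IH.
Qed.

Lemma many_seqs_path n (P : seq W -> Prop) (x : W) : many_seqs n P ->
  exists c, [/\ size c = n, path <%O x c & P c].
Proof.
elim: n P x => [|n IH] P x /=; first by exists [::].
move=> /(_ x)[y xy /(IH _ y)[c [szc pc Pc]]].
by exists (y :: c); rewrite /= szc xy.
Qed.

(** The bits of [t] say in which tree to move next; unbounded branching allows each step to go
    beyond the last point chosen in either. *)
Lemma many_seqs_interleave (t : seq bool) (P P' : seq W -> Prop) (x : W) :
  many_seqs (count negb t) P -> many_seqs (count id t) P' ->
  exists al, [/\ size al = size t, path <%O x al,
    P (mask (map negb t) al) & P' (mask t al)].
Proof.
elim: t P P' x => [|b t IH] P P' x /=; first by exists [::].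
case: b => /= [hP /(_ x)[y xy hP']|/(_ x)[y xy hP] hP'].
- have [al [sz pal h h']] := IH _ _ y hP hP'.
  by exists (y :: al); rewrite /= sz xy.
- have [al [sz pal h h']] := IH _ _ y hP hP'.
  by exists (y :: al); rewrite /= sz xy.
Qed.

(** * Stationary sets *)

(* Equivalent to meeting every club: the limit points closed under a function
   form a club, and every club contains such a set. *)
Definition stationary A := forall G : W -> W,
  exists b, [/\ A b, limit_ordinal b & forall x, x < b -> G x < b].

Lemma stationary_mono A B : A `<=` B -> stationary A -> stationary B.
Proof. by move=> AB sA G; have [b [/AB]] := sA G; exists b. Qed.

Lemma stationaryT : stationary [set: W].
Proof.
move=> G; have [_ _ cW] := W_omega1.
(* [g x] dominates [G] on the whole countable segment up to [x], so the supremum of the iterates of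
   [g] is a closed limit. *)
have /choice[g gP] : forall x : W, exists y, x < y /\ forall z, z <= x -> G z < y.
  move=> x; have /countable_injP[r rinj] := cW x.
  have [y yP] : exists y, forall z, z < x -> G z < y.
    have /choice[u uP] : forall i : nat, exists y,
        forall z, z < x -> r z = i -> y = G z.
      move=> i; have [[z [zx rz]]|nz] := pselect (exists z, z < x /\ r z = i).
        exists (G z) => z' z'x rz'; congr G; apply: rinj; rewrite ?inE //.
        by rewrite rz rz'.
      by exists x => z zx rz; case: nz; exists z.
    have [y yP] := countable_bounded u; exists y => z zx.
    by rewrite -(uP _ z zx erefl).
  have [y' yy' xy'] := exists_gt2 y x; have [y'' y'y'' Gy''] := exists_gt2 y' (G x).
  exists y''; split=> [|z]; first exact: lt_trans xy' _.
  rewrite le_eqVlt => /orP[/eqP->//|/yP Gz].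
  exact: lt_trans Gz (lt_trans yy' _).
have [x0 _] := omega1_inhabited.
pose u n := iter n g x0.
have [|b bP bmin] := @least_element (fun b => forall n, u n < b).
  exact: countable_bounded.
have blim x : x < b -> exists n, x <= u n.
  move=> xb; apply: contrapT => nx.
  suff /bmin : forall n, u n < x by rewrite leNgt xb.
  by move=> n; rewrite ltNge; apply/negP => xu; apply: nx; exists n.
exists b; split=> //.
  split=> [|x /blim[n xn]]; first by exists (u 0%N); apply: bP.
  exists (u n.+1) => //; apply: le_lt_trans xn _; exact: (gP _).1.
move=> x /blim[n xn]; apply: lt_trans (bP n.+1); exact: (gP _).2.
Qed.

(** If [G k] witnesses that the piece [k] is not stationary, a point of [A] closed under a function
    above all [G k] lies in no piece. *)
Lemma stationary_pigeonhole (T : countType) A (B : T -> set W) :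
  stationary A -> A `<=` [set x | exists k, B k x] ->
  exists k, stationary (A `&` B k).
Proof.
move=> sA AB; apply: contrapT => nS.
have /choice[G GP] : forall k, exists G : W -> W, forall b, A b -> B k b ->
    limit_ordinal b -> ~ forall x, x < b -> G x < b.
  move=> k; have /existsNP[G nG] : ~ stationary (A `&` B k).
    by move=> sk; apply: nS; exists k.
  by exists G => b Ab Bb lb cb; apply: nG; exists b.
have /choice[H HP] : forall x, exists y, forall k, G k x < y.
  by move=> x; exact: countable_bounded.
have [b [Ab lb cb]] := sA H; have [k Bkb] := AB b Ab.
by apply: (GP k b Ab Bkb lb) => x xb; exact: lt_trans (HP x k) (cb x xb).
Qed.

Lemma stationary_above A (g : W) :
  stationary A -> stationary (A `&` [set a | g < a]).
Proof.
move=> sA G.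
(* Closure under the maximum with [g] puts [g] below [b], as [b] has a predecessor [x] to apply it
   to. *)
have [b [Ab lb cb]] := sA (fun x => Order.max (G x) g).
have [[x xb] _] := lb.
exists b; split=> //; first split=> //=.
  by move: (cb x xb); rewrite gt_max => /andP[].
by move=> y /cb; rewrite gt_max => /andP[].
Qed.

(** * Ulam matrices and stationary splitting *)

Lemma ulam_matrix : exists e : W -> W -> nat,
  forall a x y, x < a -> y < a -> e a x = e a y -> x = y.
Proof.
have [_ _ cW] := W_omega1.
have /choice[e eP] : forall a, exists r : W -> nat,
    forall x y, x < a -> y < a -> r x = r y -> x = y.
  move=> a; have /countable_injP[r rinj] := cW a.
  by exists r => x y xa ya; apply: rinj; rewrite inE.
by exists e.
Qed.

Definition ulam_column (e : W -> W -> nat) n (g : W) : set W :=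
  [set a | g < a /\ e a g = n].

(** For each [y], the values [e a y] cut the part of [A] above [y] into countably many pieces; one
    value then serves unboundedly many [y]. *)
Lemma ulam_split e A : stationary A ->
  exists n, unboundedly_many (fun g => stationary (A `&` ulam_column e n g)).
Proof.
move=> sA; apply: unboundedly_many_pigeonhole => x.
have [y xy _] := exists_gt2 x x; exists y => //.
have [|n sn] := @stationary_pigeonhole nat _ (fun n => [set a | e a y = n])
    (stationary_above y sA).
  by move=> a _; exists (e a y).
by exists n; apply: stationary_mono sn => a [[]].
Qed.

Definition ulam_trace e (s : seq nat) (c : seq W) : set W :=
  [set a | all2 (fun n g => (g < a) && (e a g == n)) s c].

(** The sequence [s] found by induction depends on the first element, but there are only countably
    many finite sequences of numbers. *)
Lemma ulam_split_seqs e A N : stationary A ->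
  exists2 s, size s = N &
    many_seqs N (fun c => stationary (A `&` ulam_trace e s c)).
Proof.
elim: N A => [|N IH] A sA.
  by exists [::] => //=; apply: stationary_mono sA.
have [n nP] := ulam_split e sA.
have : unboundedly_many (fun g => exists s, size s = N /\ many_seqs N (fun c =>
    stationary (A `&` ulam_trace e (n :: s) (g :: c)))).
  apply: unboundedly_many_mono nP => g /IH[s szs sP].
  exists s; split=> //; apply: many_seqs_mono sP => c.
  apply: stationary_mono => a [[Aa [ga ean]] tr]; split=> //.
  by rewrite /ulam_trace /= ga ean eqxx.
move=> /unboundedly_many_pigeonhole[s sP]; exists (n :: s).
  have [x _] := omega1_inhabited.
  by have [g _ [<-]] := sP x.
by apply: unboundedly_many_mono sP => g [].
Qed.

Lemma disjoint_stationary : exists D : nat -> set W,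
  (forall N, stationary (D N)) /\ (forall M N a, D M a -> D N a -> M = N).
Proof.
have [e einj] := ulam_matrix.
have [n nP] := ulam_split e stationaryT.
have /choice[g gP] : forall x, exists y,
    x < y /\ stationary ([set: W] `&` ulam_column e n y).
  by move=> x; have [y] := nP x; exists y.
have [x0 _] := omega1_inhabited.
(* The points [nu i] increase strictly and [e a] is injective below [a], so the columns at different
   [nu i] are disjoint. *)
pose nu i := iter i.+1 g x0.
have numono : {homo nu : i j / (i < j)%N >-> i < j}.
  by apply: homo_ltn => [|i]; [exact: lt_trans|exact: (gP _).1].
exists (fun N => ulam_column e n (nu N)); split.
  move=> N; apply: stationary_mono (gP (iter N g x0)).2 => a []; exact.
move=> M N a [Ma eM] [Na eN].
have MN : nu M = nu N by apply: (einj a) => //; rewrite eM eN.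
by have [/numono|/numono|//] := ltngtP M N; rewrite MN ltxx.
Qed.

Lemma ulam_trace_below e s (c : seq W) (a : W) : ulam_trace e s c a ->
  size c = size s /\ forall x, x \in c -> x < a.
Proof.
rewrite /ulam_trace /=; elim: s c => [|n s IH] [|y c] //=.
move=> /andP[/andP[ya _] /IH[-> cP]]; split=> // x.
by rewrite inE => /orP[/eqP->|/cP].
Qed.

Lemma ulam_trace_inj e s (c c' : seq W) (a : W) :
  (forall a x y, x < a -> y < a -> e a x = e a y -> x = y) ->
  ulam_trace e s c a -> ulam_trace e s c' a -> c = c'.
Proof.
move=> einj; rewrite /ulam_trace /=.
elim: s c c' => [|n s IH] [|x c] [|y c'] //= /andP[/andP[xa /eqP ex] tc].
move=> /andP[/andP[ya /eqP ey] tc'].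
by rewrite (IH _ _ tc tc') (einj a x y) // ex ey.
Qed.

(** * Cofinal omega-sequences with a prescribed beginning *)

Lemma ladder (a o : W) (c : seq W) : limit_ordinal a -> o < a ->
    path <%O o c -> (forall x, x \in c -> x < a) ->
  exists E : nat -> W,
    [/\ {homo E : i j / (i < j)%N >-> i < j}, o < E 0%N, forall i, E i < a,
        forall x, x < a -> exists i, x < E i &
        forall i, (i < size c)%N -> E i = nth o c i].
Proof.
move=> [_ alim]; have [_ _ cW] := W_omega1.
elim: c o => [|y c IH] o oa /=.
  move=> _ _; have /countable_injP[r rinj] := cW a.
  have /choice[u uP] : forall i, exists x,
      x < a /\ forall z, z < a -> r z = i -> x = z.
    move=> i; have [[z [za rz]]|nz] := pselect (exists z, z < a /\ r z = i).
      exists z; split=> // z' z'a rz'.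
      by apply: rinj; rewrite ?inE //= rz rz'.
    by exists o; split=> // z za rz; case: nz; exists z.
  have /choice[g gP] : forall p : W * W, exists z,
      p.1 < a -> p.2 < a -> [/\ p.1 < z, p.2 < z & z < a].
    move=> [x y]; have [xya|nxy] := pselect (Order.max x y < a); last first.
      by exists x => /= xa ya; case: nxy; rewrite gt_max xa ya.
    have [z] := alim _ xya; rewrite gt_max => /andP[xz yz] za.
    by exists z => _ _.
  (* Each [E i] passes both its predecessor and [u i], the ordinal numbered [i] below [a]; hence [E]
     is cofinal. *)
  pose E := fix E i := if i is j.+1 then g (E j, u j.+1) else g (o, u 0%N).
  have Ea i : E i < a.
    elim: i => [|i IHi] /=; first by have [] := gP (o, u 0%N) oa (uP 0%N).1.
    by have [] := gP (E i, u i.+1) IHi (uP i.+1).1.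
  exists E; split=> //.
  - apply: homo_ltn => [|i]; first exact: lt_trans.
    by have [] := gP (E i, u i.+1) (Ea i) (uP i.+1).1.
  - by have [] := gP (o, u 0%N) oa (uP 0%N).1.
  - move=> x xa; exists (r x); rewrite -{1}((uP (r x)).2 x xa erefl).
    case: (r x) => [|i] /=; first by have [] := gP (o, u 0%N) oa (uP 0%N).1.
    by have [] := gP (E i, u i.+1) (Ea i) (uP i.+1).1.
move=> /andP[oy yc] cP.
have ya : y < a by apply: cP; rewrite inE eqxx.
have [|E [Emono E0 Ea Ecof Ec]] := IH y ya yc.
  by move=> x xc; apply: cP; rewrite inE xc orbT.
exists (fun i => if i is j.+1 then E j else y); split=> //.
- apply: homo_ltn => [|[|i]] //; [exact: lt_trans|exact: Emono].
- by case.
- by move=> x /Ecof[i xi]; exists i.+1.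
- by case=> //= i ic; rewrite Ec //; exact: set_nth_default.
Qed.

End Omega1.

(** * Positions in the range of an increasing sequence *)

Section Ladders.
Context {d : Order.disp_t} {W : orderType d}.
Context (E : nat -> W) (Emono : {homo E : i j / (i < j)%N >-> i < j}).

Lemma ladder_lt i j : (E i < E j) = (i < j)%N.
Proof.
have [/Emono//|/Emono ji|->] := ltngtP i j; last by rewrite ltxx.
by apply/negbTE; rewrite -leNgt ltW.
Qed.

Lemma ladder_inj : injective E.
Proof.
by move=> i j Eij; have [/Emono|/Emono|//] := ltngtP i j; rewrite Eij ltxx.
Qed.

Lemma nth_elt_range i g : nth_elt (range E) i g <-> g = E i.
Proof.
have seg j : range E `&` [set x | x < E j] = E @` `I_j.
  apply/seteqP; split=> [x [[l _ <-]] /=|x [l /= lj <-]].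
    by rewrite ladder_lt => lj; exists l.
  by split; [exists l|rewrite /= ladder_lt].
split=> [[[j _ <-]]|->].
  rewrite seg => -[h [hmono hr]]; congr E.
  (* The segment below [E j] has [j] elements, and its enumeration [h] shows that it has [i]. *)
  have hj : E @` `I_j #= `I_j by apply: inj_card_eq => x y _ _; exact: ladder_inj.
  have hi : range h #= [set: 'I_i].
    apply: inj_card_eq => x y _ _ hxy; apply/eqP.
    by have [/hmono|/hmono|//] := ltgtP x y; rewrite hxy ltxx.
  apply/card_eq_II.
  by rewrite -(card_eql hj) -hr (card_eql hi) card_eq_sym; exact: card_II.
split; first by exists i.
rewrite seg; exists (fun j : 'I_i => E j); split=> [j l|]; first exact: Emono.
apply/seteqP; split=> [x [j _ <-]|x [j ji <-]]; first by exists j => /=.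
by exists (Ordinal ji).
Qed.

Lemma elts_at_range I : elts_at (range E) I = E @` I.
Proof.
apply/seteqP; split=> [x [i Ii /nth_elt_range ->]|x [i Ii <-]].
  by exists i.
by exists i => //; apply/nth_elt_range.
Qed.

End Ladders.

(** * Types as bit sequences acting by [mask] *)

Definition type_seq (t : disjoint_type) : seq bool :=
  [seq t i | i <- enum 'I_(2 * width t)].

Lemma size_type_seq t : size (type_seq t) = (2 * width t)%N.
Proof. by rewrite size_map size_enum_ord. Qed.

Lemma nth_type_seq t i : nth false (type_seq t) (nat_of_ord i) = t i.
Proof. by rewrite (nth_map i) ?size_enum_ord // nth_ord_enum. Qed.

Lemma count_type_seq t :
  count negb (type_seq t) = width t /\ count id (type_seq t) = width t.
Proof.
rewrite !count_map -[X in _ = X /\ _](dt_card0 t) -[X in _ /\ _ = X](dt_card1 t).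
rewrite !cardE -!size_filter /enum_mem.
by split; congr size; apply: eq_filter => i; rewrite !inE /=; case: (t i).
Qed.

Lemma has_type_mask (d : Order.disp_t) (W : orderType d) (E E' : nat -> W)
    (t : disjoint_type) (al : seq W) :
  {homo E : i j / (i < j)%N >-> i < j} -> {homo E' : i j / (i < j)%N >-> i < j} ->
  size al = size (type_seq t) -> sorted <%O al ->
  mask (map negb (type_seq t)) al = [seq E i | i <- iota 0 (width t)] ->
  mask (type_seq t) al = [seq E' i | i <- iota 0 (width t)] ->
  has_type (E @` `I_(width t)) (E' @` `I_(width t)) t.
Proof.
move=> Emono E'mono szal sal mE mE'.
have ual : uniq al by apply: sorted_uniq sal; [exact: lt_trans|exact: ltxx].
rewrite size_type_seq in szal.
have imE (F : nat -> W) x : (F @` `I_(width t)) x <->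
    x \in [seq F i | i <- iota 0 (width t)].
  split=> [[i /= it <-]|/mapP[i]]; first by apply/map_f; rewrite mem_iota.
  by rewrite mem_iota => /andP[_ it] ->; exists i.
(* Comparing the bits with [b] treats both sides of the type at once. *)
have memE (b : bool) x : x \in mask (map (eq_op b) (type_seq t)) al <->
    exists2 i : 'I_(2 * width t), t i = b & nth x al i = x.
  rewrite in_mask //; split.
    move=> /andP[xal]; have ix : (index x al < 2 * width t)%N.
      by rewrite -szal index_mem.
    rewrite (nth_map false) ?size_type_seq // => /eqP bt.
    exists (Ordinal ix); last exact: nth_index.
    by rewrite -nth_type_seq.
  move=> [i ti ix]; have ial : (i < size al)%N by rewrite szal.
  have -> : index x al = i by rewrite -{1}ix index_uniq.
  rewrite -{1}ix mem_nth //= (nth_map false) ?size_type_seq //.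
  by rewrite nth_type_seq ti.
have EE : map (eq_op false) (type_seq t) = map negb (type_seq t).
  by apply: eq_map; case.
have EE' : map (eq_op true) (type_seq t) = type_seq t.
  by rewrite -[RHS]map_id; apply: eq_map; case.
have sE x : (E @` `I_(width t)) x <->
    exists2 i : 'I_(2 * width t), t i = false & nth x al i = x.
  by rewrite imE -mE -EE memE.
have sE' x : (E' @` `I_(width t)) x <->
    exists2 i : 'I_(2 * width t), t i = true & nth x al i = x.
  by rewrite imE -mE' -EE' memE.
have nthE (i : 'I_(2 * width t)) x y : nth x al i = nth y al i.
  by apply: set_nth_default; rewrite szal.
split.
- by apply: inj_card_eq => x y _ _; exact: ladder_inj.
- by apply: inj_card_eq => x y _ _; exact: ladder_inj.
- apply/seteqP; split=> // x [/sE[i ti xi] /sE'[j tj xj]].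
  have ij : i = j.
    by apply/ord_inj/eqP; rewrite -(nth_uniq x _ _ ual) ?szal // xi xj.
  by rewrite ij tj in ti.
(* Only a default for [nth]: all indices lie within [al]. *)
pose o := E 0%N.
exists (fun i => nth o al i); split.
- move=> i j ij; apply: (sorted_ltn_nth lt_trans) => //; rewrite inE szal //.
- apply/seteqP; split=> [x [i _ <-]|x [/sE|/sE'] [i _ <-]].
  + case ti : (t i); [right; apply/sE'|left; apply/sE]; exists i => //;
      exact: nthE.
  + by exists i => //; exact: nthE.
  + by exists i => //; exact: nthE.
- apply/seteqP; split=> [x /sE[i ti <-]|x [i /= ti <-]].
    by exists i => //; exact: nthE.
  by apply/sE; exists i => //; exact: nthE.
- apply/seteqP; split=> [x /sE'[i ti <-]|x [i /= ti <-]].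
    by exists i => //; exact: nthE.
  by apply/sE'; exists i => //; exact: nthE.
Qed.

(** * The C-sequence and its guessing property *)

Lemma stronger_guessing_strong (d : Order.disp_t) (W : orderType d)
    (C : W -> set W) (t : nat -> disjoint_type) :
  C_sequence C -> stronger_guessing C t -> strong_guessing C t.
Proof.
move=> Cseq gC f; have [b [k [lb fb bP]]] := gC f.
exists b => //= eta etab; have [a [la ab] [fa ta [g [Cg _] etag]]] := bP eta etab.
exists a; first by rewrite fb; split=> //; left.
have [Ca _ _] := Cseq a la.
exact: lt_trans etag (Ca g Cg).
Qed.

Theorem theorem2p7 (d : Order.disp_t) (W : orderType d) (W_omega1 : is_omega1 W) :
  exists C : W -> set W,
    C_sequence C /\
    (forall t : nat -> disjoint_type, bounded_width t ->
       strong_guessing C t /\ stronger_guessing C t).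
Proof.
have [e einj] := ulam_matrix W_omega1.
have [D [Dstat Ddisj]] := disjoint_stationary W_omega1.
have [o omin] : exists o : W, forall x, o <= x.
  have [o _ omin] := least_element W_omega1 (omega1_inhabited W_omega1).
  by exists o => x; apply: omin.
have /choice[s sP] : forall N, exists s, size s = N /\
    many_seqs N (fun c => stationary (D N `&` ulam_trace e s c)).
  by move=> N; have [s] := ulam_split_seqs W_omega1 e N (Dstat N); exists s.
have /choice[E EP] : forall a, exists E : nat -> W, limit_ordinal a ->
    [/\ {homo E : i j / (i < j)%N >-> i < j}, forall i, E i < a,
        forall x, x < a -> exists i, x < E i &
        forall N c, D N a -> ulam_trace e (s N) c a -> path <%O o c ->
          forall i, (i < N)%N -> E i = nth o c i].
  move=> a; have [la|nla] := pselect (limit_ordinal a); last by exists (fun=> a).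
  have oa : o < a by have [[x xa] _] := la; exact: le_lt_trans (omin x) xa.
  (* At most one branch lies under [a]: disjointness of the [D N] fixes [N], and injectivity of
     [e a] fixes [c]. Without one, any ladder will do. *)
  have [[N [c [DNa tr pc]]]|nNc] := pselect (exists N c,
      [/\ D N a, ulam_trace e (s N) c a & path <%O o c]); last first.
    have [//|E [Emono _ Ea Ecof _]] := ladder W_omega1 (c := [::]) la oa isT.
    by exists E => _; split=> // N c DNa tr pc; case: nNc; exists N, c.
  have [|E [Emono _ Ea Ecof Ec]] := ladder W_omega1 la oa pc.
    exact: (ulam_trace_below tr).2.
  exists E => _; split=> // M c' DMa tr' pc' i.
  have NM := Ddisj _ _ _ DNa DMa; rewrite -{M DMa}NM in tr' *.
  have <- := ulam_trace_inj einj tr tr'.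
  by rewrite -(sP N).1 -(ulam_trace_below tr).1; exact: Ec.
pose C a := range (E a).
have Cseq : C_sequence C.
  move=> a /EP[Emono Ea Ecof _]; split; last by exists (E a).
  - by move=> _ [i _ <-] /=; exact: Ea.
  - by move=> x /Ecof[i xi]; exists (E a i) => //; exists i.
exists C; split=> // t [B tB].
suff gC : stronger_guessing C t by split=> //; exact: stronger_guessing_strong.
(* The length exceeds every width, so that the branch also controls the element of index [n]. *)
move=> f; pose N := B.+1.
have [k kP] : exists k, many_seqs N (fun c =>
    stationary (D N `&` ulam_trace e (s N) c `&` [set a | f a = k])).
  apply: many_seqs_pigeonhole => //; apply: many_seqs_mono (sP N).2 => c sc.
  by apply: stationary_pigeonhole => // a _; exists (f a).
set R := (X in many_seqs N X) in kP.
set n := width (t k); pose m := (N - n)%N.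
have nN : (n < N)%N by rewrite ltnS tB.
have m0 : (0 < m)%N by rewrite subn_gt0.
pose tt := type_seq (t k); have [ct0 ct1] := count_type_seq (t k).
have Rn : many_seqs n (fun c => many_seqs m (fun c' => R (c ++ c'))).
  by apply: many_seqs_cat; rewrite subnKC // ltnW.
have [al [szal pal Ra Rb]] : exists al, [/\ size al = size tt, path <%O o al,
    many_seqs m (fun c' => R (mask (map negb tt) al ++ c')) &
    many_seqs m (fun c' => R (mask tt al ++ c'))].
  by apply: (many_seqs_interleave (P := fun c => many_seqs m (fun c' => R (c ++ c')))
    (P' := fun c => many_seqs m (fun c' => R (c ++ c')))); rewrite ?ct0 ?ct1.
have sza : size (mask (map negb tt) al) = n.
  rewrite size_mask; first by rewrite count_map -[RHS]ct0; apply: eq_count.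
  by rewrite (size_map negb) szal.
have szb : size (mask tt al) = n by rewrite size_mask ?szal.
(* Extensions of either branch chosen beyond [x] stay increasing, since [x] is above [o] and all of
   [al]. *)
have [x xP] := countable_bounded W_omega1 (nth o (o :: al)).
have x_last mk : last o (mask mk al) < x.
  have : last o (mask mk al) \in o :: al.
    have := mem_last o (mask mk al); rewrite !inE => /orP[->//|/mem_mask->].
    exact: orbT.
  by move=> /nthP-/(_ o)[i _ <-].
have pathcat mk y c : x <= y -> path <%O y c -> path <%O o (mask mk al ++ c).
  move=> xy pc; rewrite cat_path path_mask //=; last exact: lt_trans.
  by apply: path_le pc; [exact: lt_trans|exact: lt_le_trans (x_last mk) xy].
have Ein a mk c y : limit_ordinal a -> D N a -> x <= y -> path <%O y c ->
    size (mask mk al) = n -> ulam_trace e (s N) (mask mk al ++ c) a ->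
    mask mk al = [seq E a i | i <- iota 0 n] /\ E a n = nth o c 0.
  move=> la DNa xy pc szm tr; have [_ _ _ Ec] := EP a la.
  have {}Ec := Ec _ _ DNa tr (pathcat mk y c xy pc).
  split; last by rewrite Ec // nth_cat szm ltnn subnn.
  apply: (@eq_from_nth _ o) => [|i]; first by rewrite size_map size_iota.
  rewrite szm => ni; rewrite (nth_map 0%N) ?size_iota // nth_iota // add0n.
  by rewrite Ec ?(ltn_trans ni) // nth_cat szm ni.
have /choice[G GP] : forall eta, exists a, [/\ limit_ordinal a, f a = k, D N a &
    exists c, [/\ size c = m, path <%O (Order.max x eta) c &
      ulam_trace e (s N) (mask (map negb tt) al ++ c) a]].
  (* Stationarity is applied to [id] merely to pick some limit ordinal; [c] starts beyond [eta], for
     clause (iii). *)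
  move=> eta; have [c [szc pc /(_ id)[a [[[DNa tr] fa] la _]]]] :=
    many_seqs_path (Order.max x eta) Ra.
  by exists a; split=> //; exists c.
have [c [szc pc /(_ G)[b [[[DNb trb] fb] lb Gb]]]] := many_seqs_path x Rb.
exists b, k; split=> // eta etab; exists (G eta).
  by have [la _ _ _] := GP eta; split=> //; exact: Gb.
have [la fa DNa [c' [szc' pc' tra]]] := GP eta.
have [Eamono _ _ _] := EP _ la; have [Ebmono _ _ _] := EP _ lb.
have [mb _] := Ein b tt c x lb DNb (lexx x) pc szb trb.
have xmax : x <= Order.max x eta by rewrite le_max lexx.
have [ma En] := Ein (G eta) (map negb tt) c' _ la DNa xmax pc' sza tra.
split=> //.
  rewrite !elts_at_range //; apply: (has_type_mask (al := al)) => //.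
  exact: path_sorted pal.
exists (E (G eta) n); first exact/nth_elt_range.
(* As [m] is positive, [c'] has a first entry, which is [E (G eta) n]. *)
rewrite En; case: c' szc' pc' {tra En} => [m00|y c' _ /= /andP[]].
  by rewrite -m00 in m0.
by rewrite gt_max => /andP[].
Qed.
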